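(* Let $0<\varepsilon\le 1$, and consider the first order IMEX scheme (semi-discrete in time, continuous in space) described in the context, consisting of (S1)–(S4) together with the elliptic equation (EL). Assume that: (i) the initial data ($n=0$) are well prepared, that is, the expansions $$\rho^n=\rho_0^n+\varepsilon^2\rho_2^n,\quad (\rho\mathbf u)^n=(\rho\mathbf u)_0^n+\varepsilon(\rho\mathbf u)_1^n,\quad p^n=p_0^n+\varepsilon^2p_2^n,\quad \theta^n=\theta_0^n+\varepsilon^2\theta_2^n$$ hold at $n=0$, and $$\nabla\cdot(\rho\mathbf u)_0^0=0,\qquad \nabla p_0^0=-\rho_0^0\nabla\Phi;$$ (ii) the same expansions hold at all later time levels $n\ge1$; (iii) at the new time level, $p^{n+1}=p_0(\mathbf x)+\varepsilon^2p_2^{n+1}$ and $\rho^{n+1}=\rho_0(\mathbf x)+\varepsilon^2\rho_2^{n+1}$, where the background states satisfy $\nabla p_0=-\rho_0\nabla\Phi$, and the background potential temperature $\theta_0$ is a constant. Then the scheme is asymptotic preserving: as $\varepsilon\to0$, its limiting scheme is a consistent discretization (in time) of the incompressible system $$\nabla\cdot(\rho_0\mathbf u_0)=0,\qquad (\rho_0\mathbf u_0)_t+\nabla\cdot(\rho_0\mathbf u_0\otimes\mathbf u_0)+\nabla p_2=-\rho_2\nabla\Phi,\qquad (\theta_2)_t+\mathbf u_0\cdot\nabla\theta_2=0,$$ closed by $p_2=\frac{\gamma p_0}{\rho_0\theta_0}(\rho_0\theta_2+\theta_0\rho_2)$.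
   Context: **Model.** $\rho$ is density, $\mathbf u$ velocity, $\rho\mathbf u$ momentum, $p$ pressure, $E$ total non-gravitational energy, and $\Phi=\Phi(\mathbf x)$ a given time-independent gravitational potential. $\gamma>1$ is a constant and $\varepsilon$ is the Mach number. The equation of state is $E=\frac12\varepsilon^2\rho|\mathbf u|^2+\frac{p}{\gamma-1}$. The potential temperature $\theta$ is defined by $p=(\rho\theta)^\gamma$, and its perturbation $\theta_2$ by $\theta(\mathbf x,t)=\theta_0(\mathbf x)+\varepsilon^2\theta_2(\mathbf x,t)$ with $\theta_0$ a prescribed time-independent background. The system being discretized is $$\rho_t+\nabla\cdot(\rho\mathbf u)=0,\qquad (\rho\mathbf u)_t+\nabla\cdot(\rho\mathbf u\otimes\mathbf u)+\tfrac1{\varepsilon^2}\nabla p=-\tfrac1{\varepsilon^2}\rho\nabla\Phi,$$ $$E_t+\nabla\cdot((E+p)\mathbf u)=-\rho\mathbf u\cdot\nabla\Phi,\qquad (\theta_2)_t+\mathbf u\cdot\nabla\theta_2+\tfrac1{\varepsilon^2}\mathbf u\cdot\nabla\theta_0=0.$$ **Background.** $\rho_0(\mathbf x),p_0(\mathbf x)$ are time-independent hydrostatic states with $\nabla p_0=-\rho_0\nabla\Phi$ and $p_0=(\rho_0\theta_0)^\gamma$. They are the leading-order terms in the expansions of $\rho$ and $p$; in particular $\rho_0^0=\rho_0$ and $p_0^0=p_0$. **First order IMEX scheme.** With time step $\Delta t$, a superscript $n$ denotes the value at $t^n$, $\mathbb I$ is the identity matrix, and $$\text{(S1)}\quad \frac{\rho^{n+1}-\rho^n}{\Delta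 t}+\varepsilon^2\nabla\cdot(\rho\mathbf u)^n+(1-\varepsilon^2)\nabla\cdot(\rho\mathbf u)^{n+1}=0,$$ $$\text{(S2)}\quad \frac{(\rho\mathbf u)^{n+1}-(\rho\mathbf u)^n}{\Delta t}+\nabla\cdot(\rho\mathbf u\otimes\mathbf u+p\,\mathbb I)^n+\frac{1-\varepsilon^2}{\varepsilon^2}\nabla p^{n+1}=-\rho^n\nabla\Phi-\frac{1-\varepsilon^2}{\varepsilon^2}\rho^{n+1}\nabla\Phi,$$ $$\text{(S3)}\quad \frac{E^{n+1}-E^n}{\Delta t}+\varepsilon^2\nabla\cdot((E+p)\mathbf u)^n+(1-\varepsilon^2)\nabla\cdot((E+p)\mathbf u)^{n+1}=-\varepsilon^2(\rho\mathbf u)^n\cdot\nabla\Phi-(1-\varepsilon^2)(\rho\mathbf u)^{n+1}\cdot\nabla\Phi,$$ $$\text{(S4)}\quad \frac{\theta_2^{n+1}-\theta_2^n}{\Delta t}+\mathbf u^n\cdot\nabla\theta_2^n+\frac1{\varepsilon^2}\mathbf u^n\cdot\nabla\theta_0=0.$$ Put $\widetilde\rho=\rho^n-\Delta t\,\varepsilon^2\nabla\cdot(\rho\mathbf u)^n$ and $\widetilde{\rho\mathbf u}=(\rho\mathbf u)^n-\Delta t\big(\nabla\cdot(\rho\mathbf u\otimes\mathbf u+p\,\mathbb I)^n+\rho^n\nabla\Phi\big)$. Writing $p^{n+1}=p_0+\varepsilon^2p_2^{n+1}$ and $\rho^{n+1}=\rho_0+\varepsilon^2\rho_2^{n+1}$,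 the combination of (S1) and (S2) gives $$\text{(EL)}\quad \varepsilon^2\rho_2^{n+1}=\widetilde\rho-(1-\varepsilon^2)\Delta t\,\nabla\cdot(\widetilde{\rho\mathbf u})+\Delta t^2(1-\varepsilon^2)^2\nabla\cdot\big(\nabla p_2^{n+1}+\rho_2^{n+1}\nabla\Phi\big)-\rho_0.$$ Here $p_2^{n+1}=\frac{\gamma p_0}{\rho_0\theta_0}\big(\rho_0\theta_2^{n+1}+\rho_2^{n+1}\theta^{n+1}\big)$ with $\theta^{n+1}=\theta_0+\varepsilon^2\theta_2^{n+1}$, an $\mathcal O(\varepsilon^2)$ linearization of $p=(\rho\theta)^\gamma$. A step is carried out as follows. First $\theta_2^{n+1}$ is computed from (S4), then $\rho_2^{n+1}$ from (EL) and $p_2^{n+1}$ from the linearized relation, and then $(\rho\mathbf u)^{n+1}$ from (S2) using $\rho_0+\varepsilon^2\rho_2^{n+1}$ and $p_0+\varepsilon^2p_2^{n+1}$. Next $\rho^{n+1}$ is updated by (S1). Finally $E^{n+1}$ is computed from (S3), where $((E+p)\mathbf u)^{n+1}=H^{n+1}(\rho\mathbf u)^{n+1}$, $H^{n+1}=\frac{\gamma}{\gamma-1}\frac{p^{n+1}}{\rho^{n+1}}+\frac12\varepsilon^2\frac{|(\rho\mathbf u)^{n+1}|^2}{(\rho^{n+1})^2}$, with $p^{n+1}=p_0+\varepsilon^2p_2^{n+1}$ and $\rho^{n+1}=\rho_0+\varepsilon^2\rho_2^{n+1}$ in $H^{n+1}$. **Conventions.** The analysis is at the level of formal asymptotics: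 all functions are smooth in $\mathbf x$, and the coefficients in the expansions (which may depend on $\varepsilon$) are bounded and converge, together with their spatial derivatives, as $\varepsilon\to0$. The *limiting scheme* is the system of relations satisfied by the limiting coefficients $\rho_0^n,(\rho\mathbf u)_0^n,p_0^n,\rho_2^n,p_2^n,\theta_2^n$ obtained by letting $\varepsilon\to0$ with $\Delta t$ fixed; $\mathbf u_0^n=(\rho\mathbf u)_0^n/\rho_0^n$. It is a *consistent discretization* of the limit system if it imposes the divergence constraint $\nabla\cdot(\rho\mathbf u)_0^{n+1}=0$ at the new time level, and its update relations for momentum and $\theta_2$ are time discretizations of the corresponding equations of the limit system, i.e. inserting a smooth solution of the limit system leaves a residual tending to $0$ as $\Delta t\to0$. *)

(* Defs.v *)
From HB Require Import structures.
From mathcomp Require Import all_boot all_order all_algebra.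
From mathcomp Require Import all_classical all_reals all_analysis.

Set Implicit Arguments.
Unset Strict Implicit.
Unset Printing Implicit Defensive.

Import Order.TTheory GRing.Theory Num.Theory.
Import numFieldNormedType.Exports.
Local Open Scope classical_set_scope.
Local Open Scope ring_scope.

Section Smooth.
Context {R : realType} {U W : normedModType R}.

Definition iter_derive (s : seq U) (f : U -> W) : U -> W :=
  foldr (fun (v : U) (g : U -> W) => 'D_v g) f s.

(* Differentiability of all iterated directional derivatives is C^infinity on
   an open set. *)
Definition smooth_on (O : set U) (f : U -> W) : Prop :=
  forall s x, O x -> differentiable (iter_derive s f) x.

(* Boundedness and convergence of a family of coefficients with all its
   spatial derivatives; both are only required pointwise in x, which is implied
   by any stronger (for instance locally uniform) mode. *)
Definition coeff_cvg (O : set U) (f : R -> U -> W) (g : U -> W) : Prop :=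
  (forall eps, 0 < eps <= 1 -> smooth_on O (f eps)) /\ smooth_on O g /\
  forall s x, O x ->
    (exists M : R, forall eps, 0 < eps <= 1 ->
       `|iter_derive s (f eps) x| <= M) /\
    iter_derive s (f eps) x @[eps --> 0^'+] --> iter_derive s g x.

End Smooth.

Section Operators.
Context {R : realType} {d : nat}.
Local Notation V := 'rV[R]_d.

Definition partial (i : 'I_d) (f : V -> R) (x : V) : R :=
  'D_(delta_mx 0 i : V) f x.

Definition grad (f : V -> R) (x : V) : V := \row_i partial i f x.

Definition dive (u : V -> V) (x : V) : R :=
  \sum_i partial i (fun y => u y 0 i) x.

Definition divT (T : V -> 'M[R]_d) (x : V) : V :=
  \row_j \sum_i partial i (fun y => T y i j) x.

Definition dot (u v : V) : R := \sum_i u 0 i * v 0 i.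

Definition outer (u v : V) : 'M[R]_d := u^T *m v.

End Operators.

Section Model.
Context {R : realType} {d : nat}.
Local Notation V := 'rV[R]_d.

Record background := Background {
  Omega : set V;
  Phi : V -> R;
  rho0 : V -> R;
  p0 : V -> R;
  theta0 : V -> R }.

Definition is_background (gamma : R) (B : background) : Prop :=
  open (Omega B) /\
  smooth_on (Omega B) (Phi B) /\ smooth_on (Omega B) (rho0 B) /\
  smooth_on (Omega B) (p0 B) /\ smooth_on (Omega B) (theta0 B) /\
  forall x, Omega B x ->
    0 < rho0 B x /\ 0 < theta0 B x /\
    p0 B x = (rho0 B x * theta0 B x) `^ gamma /\
    grad (p0 B) x = - rho0 B x *: grad (Phi B) x.

(* All time levels of one run of the scheme.  The scheme carries two pressures
   at a new level: p0 + eps^2 p2, with p2 given by the linearized relation and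
   used in the implicit terms, and p, recovered from the conserved energy E by
   the equation of state and used in the explicit terms of the next step. *)
Record run := Run {
  rho : nat -> V -> R;
  mom : nat -> V -> V;
  E : nat -> V -> R;
  p : nat -> V -> R;
  theta2 : nat -> V -> R;
  rho2 : nat -> V -> R;
  p2 : nat -> V -> R }.

Section Scheme.
Variables (gamma eps dt : R) (B : background) (S : run).

Definition vel n y : V := (rho S n y)^-1 *: mom S n y.

Definition theta n y : R := theta0 B y + eps ^+ 2 * theta2 S n y.

Definition rho_imp n y : R := rho0 B y + eps ^+ 2 * rho2 S n y.

Definition p_imp n y : R := p0 B y + eps ^+ 2 * p2 S n y.

Definition mom_flux n y : 'M[R]_d :=
  rho S n y *: outer (vel n y) (vel n y) + (p S n y)%:M.

Definition rho_tilde n y : R :=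
  rho S n y - dt * eps ^+ 2 * dive (mom S n) y.

Definition mom_tilde n y : V :=
  mom S n y - dt *: (divT (mom_flux n) y + rho S n y *: grad (Phi B) y).

Definition enthalpy_imp n y : R :=
  gamma / (gamma - 1) * (p_imp n y / rho_imp n y) +
  2^-1 * eps ^+ 2 * (dot (mom S n y) (mom S n y) / rho_imp n y ^+ 2).

Definition eq_state n x : Prop :=
  E S n x = 2^-1 * eps ^+ 2 * rho S n x * dot (vel n x) (vel n x)
            + p S n x / (gamma - 1).

Definition eq_S1 n x : Prop :=
  (rho S n.+1 x - rho S n x) / dt + eps ^+ 2 * dive (mom S n) x
  + (1 - eps ^+ 2) * dive (mom S n.+1) x = 0.

Definition eq_S2 n x : Prop :=
  dt^-1 *: (mom S n.+1 x - mom S n x) + divT (mom_flux n) x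
  + ((1 - eps ^+ 2) / eps ^+ 2) *: grad (p_imp n.+1) x
  = - rho S n x *: grad (Phi B) x
    - ((1 - eps ^+ 2) / eps ^+ 2 * rho_imp n.+1 x) *: grad (Phi B) x.

Definition eq_S3 n x : Prop :=
  (E S n.+1 x - E S n x) / dt
  + eps ^+ 2 * dive (fun y => (E S n y + p S n y) *: vel n y) x
  + (1 - eps ^+ 2) *
      dive (fun y => enthalpy_imp n.+1 y *: mom S n.+1 y) x
  = - (eps ^+ 2 * dot (mom S n x) (grad (Phi B) x))
    - (1 - eps ^+ 2) * dot (mom S n.+1 x) (grad (Phi B) x).

Definition eq_S4 n x : Prop :=
  (theta2 S n.+1 x - theta2 S n x) / dt
  + dot (vel n x) (grad (theta2 S n) x)
  + (eps ^+ 2)^-1 * dot (vel n x) (grad (theta0 B) x) = 0.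

Definition eq_EL n x : Prop :=
  eps ^+ 2 * rho2 S n.+1 x
  = rho_tilde n x - (1 - eps ^+ 2) * dt * dive (mom_tilde n) x
    + dt ^+ 2 * (1 - eps ^+ 2) ^+ 2 *
        dive (fun y => grad (p2 S n.+1) y
                       + rho2 S n.+1 y *: grad (Phi B) y) x
    - rho0 B x.

Definition eq_lin n x : Prop :=
  p2 S n.+1 x = gamma * p0 B x / (rho0 B x * theta0 B x) *
    (rho0 B x * theta2 S n.+1 x + rho2 S n.+1 x * theta n.+1 x).

Definition imex_scheme : Prop :=
  forall n x, Omega B x ->
    0 < rho S n x /\ eq_state n x /\
    eq_S1 n x /\ eq_S2 n x /\ eq_S3 n x /\ eq_S4 n x /\
    eq_EL n x /\ eq_lin n x.

End Scheme.

(* Coefficients of the expansions.  Those of rho and theta at order eps^2 are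
   the fields rho2 and theta2 of the run, and theta_0^n is the background
   theta0; pcoef2 is the coefficient of the equation-of-state pressure p. *)
Record coeffs := Coeffs {
  rhocoef0 : nat -> V -> R;
  momcoef0 : nat -> V -> V;
  momcoef1 : nat -> V -> V;
  pcoef0 : nat -> V -> R;
  pcoef2 : nat -> V -> R }.

Definition expansion (eps : R) (B : background) (S : run) (C : coeffs)
    (n : nat) : Prop :=
  forall x, Omega B x ->
    rho S n x = rhocoef0 C n x + eps ^+ 2 * rho2 S n x /\
    mom S n x = momcoef0 C n x + eps *: momcoef1 C n x /\
    p S n x = pcoef0 C n x + eps ^+ 2 * pcoef2 C n x.

Definition well_prepared (gamma eps : R) (B : background) (S : run)
    (C : coeffs) : Prop :=
  expansion eps B S C 0 /\
  forall x, Omega B x ->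
    dive (momcoef0 C 0%N) x = 0 /\
    grad (pcoef0 C 0%N) x = - rhocoef0 C 0%N x *: grad (Phi B) x /\
    rhocoef0 C 0%N x = rho0 B x /\ pcoef0 C 0%N x = p0 B x /\
    pcoef2 C 0%N x = p2 S 0%N x /\
    0 < theta eps B S 0 x /\
    p S 0%N x = (rho S 0%N x * theta eps B S 0 x) `^ gamma.

Definition new_level_density (eps : R) (B : background) (S : run) : Prop :=
  forall n x, Omega B x -> rho S n.+1 x = rho_imp eps B S n.+1 x.

Record limstate := LimState {
  lrho0 : V -> R;
  lmom0 : V -> V;
  lp0 : V -> R;
  lrho2 : V -> R;
  lp2 : V -> R;
  ltheta2 : V -> R }.

Definition lvel (w : limstate) y : V := (lrho0 w y)^-1 *: lmom0 w y.

Definition limit_coeffs (B : background) (S : R -> run) (C : R -> coeffs)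
    (L : nat -> limstate) : Prop :=
  forall n,
    coeff_cvg (Omega B) (fun eps => rhocoef0 (C eps) n) (lrho0 (L n)) /\
    coeff_cvg (Omega B) (fun eps => momcoef0 (C eps) n) (lmom0 (L n)) /\
    coeff_cvg (Omega B) (fun eps => pcoef0 (C eps) n) (lp0 (L n)) /\
    coeff_cvg (Omega B) (fun eps => rho2 (S eps) n) (lrho2 (L n)) /\
    coeff_cvg (Omega B) (fun eps => p2 (S eps) n) (lp2 (L n)) /\
    coeff_cvg (Omega B) (fun eps => theta2 (S eps) n) (ltheta2 (L n)) /\
    (exists m1, coeff_cvg (Omega B) (fun eps => momcoef1 (C eps) n) m1) /\
    (exists q2, coeff_cvg (Omega B) (fun eps => pcoef2 (C eps) n) q2).

(* A one-step time discretization: constraints imposed at the new level, and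
   residuals of the momentum and theta_2 updates from one level to the next,
   scaled like the differential equations. *)
Record time_scheme := TimeScheme {
  constraint : limstate -> Prop;
  mom_res : R -> limstate -> limstate -> V -> V;
  theta_res : R -> limstate -> limstate -> V -> R }.

Definition scheme_step (B : background) (Sch : time_scheme) (dt : R)
    (w w' : limstate) : Prop :=
  constraint Sch w' /\
  forall x, Omega B x ->
    mom_res Sch dt w w' x = 0 /\ theta_res Sch dt w w' x = 0.

Definition closure_p2 (gamma : R) (B : background) (r2 t2 : V -> R) x : R :=
  gamma * p0 B x / (rho0 B x * theta0 B x) *
    (rho0 B x * t2 x + theta0 B x * r2 x).

Definition limiting_scheme (gamma : R) (B : background) : time_scheme := {|
  constraint := fun w => forall x, Omega B x ->
    lrho0 w x = rho0 B x /\ lp0 w x = p0 B x /\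
    dive (lmom0 w) x = 0 /\
    lp2 w x = closure_p2 gamma B (lrho2 w) (ltheta2 w) x;
  mom_res := fun dt w w' x =>
    dt^-1 *: (lmom0 w' x - lmom0 w x)
    + divT (fun y => lrho0 w y *: outer (lvel w y) (lvel w y)) x
    + grad (lp2 w') x + lrho2 w' x *: grad (Phi B) x;
  theta_res := fun dt w w' x =>
    (ltheta2 w' x - ltheta2 w x) / dt
    + dot (lvel w x) (grad (ltheta2 w) x) |}.

Definition spacetime (B : background) (T : R) : set (R * V) :=
  [set z | 0 < z.1 < T /\ Omega B z.2].

Definition limit_solution (gamma : R) (B : background) (T : R)
    (u : R -> V -> V) (r2 q2 t2 : R -> V -> R) : Prop :=
  smooth_on (spacetime B T) (fun z => u z.1 z.2) /\
  smooth_on (spacetime B T) (fun z => r2 z.1 z.2) /\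
  smooth_on (spacetime B T) (fun z => q2 z.1 z.2) /\
  smooth_on (spacetime B T) (fun z => t2 z.1 z.2) /\
  forall t x, spacetime B T (t, x) ->
    dive (fun y => rho0 B y *: u t y) x = 0 /\
    derive1 (fun s => rho0 B x *: u s x) t
      + divT (fun y => rho0 B y *: outer (u t y) (u t y)) x
      + grad (q2 t) x = - r2 t x *: grad (Phi B) x /\
    derive1 (fun s => t2 s x) t + dot (u t x) (grad (t2 t) x) = 0 /\
    q2 t x = closure_p2 gamma B (r2 t) (t2 t) x.

Definition state_of (B : background) (u : V -> V) (r2 q2 t2 : V -> R) :
    limstate :=
  LimState (rho0 B) (fun y => rho0 B y *: u y) (p0 B) r2 q2 t2.

(* Residuals tend to 0 locally uniformly in (t, x). *)
Definition consistent_discretization (gamma : R) (B : background)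
    (Sch : time_scheme) : Prop :=
  (forall w, constraint Sch w ->
     forall x, Omega B x -> dive (lmom0 w) x = 0) /\
  forall T u r2 q2 t2, limit_solution gamma B T u r2 q2 t2 ->
    let w t := state_of B (u t) (r2 t) (q2 t) (t2 t) in
    (forall t, 0 < t < T -> constraint Sch (w t)) /\
    forall K : set (R * V), compact K -> K `<=` spacetime B T ->
      forall e : R, 0 < e -> \forall dt \near 0^'+,
        forall t x, K (t, x) ->
          `|mom_res Sch dt (w t) (w (t + dt)) x| < e /\
          `|theta_res Sch dt (w t) (w (t + dt)) x| < e.

End Model.

Arguments background : clear implicits.
Arguments run : clear implicits.
Arguments coeffs : clear implicits.
Arguments limstate : clear implicits.
Arguments time_scheme : clear implicits.

(* Main.v *)
Require Import Defs.
From HB Require Import structures.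
From mathcomp Require Import all_boot all_order all_algebra.
From mathcomp Require Import all_classical all_reals all_analysis.
From mathcomp Require Import ring lra.

Set Implicit Arguments.
Unset Strict Implicit.
Unset Printing Implicit Defensive.

Import Order.TTheory GRing.Theory Num.Theory.
Import numFieldNormedType.Exports.
Local Open Scope classical_set_scope.
Local Open Scope ring_scope.

(** Every relation of the scheme is an identity between sums and products of
the fields and of their first spatial derivatives.  If each field converges at
a point together with its first derivatives ([C1cvg]), one may let the Mach
number [eps] tend to 0 in each relation separately, at that point.  At every
time level the density tends to [rho0], the momentum to [lmom0], the
equation-of-state pressure to [lp0] and the energy to [lp0 / (gamma - 1)],
because the kinetic energy carries a factor [eps ^+ 2].  The relations then
give the limiting scheme.

- Mass: both densities tend to [rho0], so the time difference disappears and
  what remains is the divergence constraint at the new level ([dive_lmom0]).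
- Energy: the limiting enthalpy is [gamma / (gamma - 1) * (p0 / rho0)].  As
  [theta0] is constant, [p0] is a multiple of [rho0 `^ gamma], and together
  with the hydrostatic balance this makes the gradient of the enthalpy
  [- grad Phi] ([derive_enthalpy0]).  The divergence constraint then identifies
  the energy flux with the gravitational work, so the limiting pressure does
  not change from one level to the next and stays equal to [p0] ([lp0E]).
- Momentum: the terms of size [eps ^- 2] cancel by the hydrostatic balance of
  [p0] and [rho0] at the new level.  The balance is used once more at the old
  level, where [lp0E] shows that the explicit pressure gradient cancels the
  explicit weight.  What is left is driven by [lp2] and [lrho2]
  ([limit_momentum]).
- The update of [theta2] and the linearized pressure relation pass to the
  limit directly ([limit_theta], [lp2E]); the former has no singular term since
  [grad theta0 = 0].

For consistency, a smooth solution of the limit system is inserted into these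
updates.  After subtracting the differential equation, the residual is the
error of a forward difference quotient in time plus, in the momentum equation,
the increment over one step of the continuous force
[grad q2 + r2 *: grad Phi].  By the mean value theorem both are small for small
steps, uniformly near every point of space-time; compactness turns this into
uniformity on compact sets ([residuals_cvg0]). *)

(** * Convergence of values and first derivatives at a point *)

Section C1Convergence.
Context {R : realType} {V : normedModType R} {I : Type} (F : set_system I)
  {FF : ProperFilter F} (x v : V).
Implicit Types (f : I -> V -> R) (g : V -> R).

(** Derivatives are only taken in the direction [v], and differentiability of
[f i] is only required eventually.  This is weak enough to be stable under
every operation occurring in the scheme, inverses included. *)
Definition C1cvg f g : Prop :=
  [/\ \forall i \near F, derivable (f i) x v, derivable g x v,
      f i x @[i --> F] --> g x & 'D_v (f i) x @[i --> F] --> 'D_v g x].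

(** The fields of a run are known only on the domain [Omega], which is open;
hence the agreement on neighbourhoods of [x] instead of everywhere. *)
Lemma C1cvg_congr f f' g g' :
  (\forall i \near F, \forall y \near x, f i y = f' i y) ->
  (\forall y \near x, g y = g' y) -> C1cvg f g -> C1cvg f' g'.
Proof.
move=> ff gg [df dg fg Dfg]; split.
- by apply: filterS2 ff df => i; exact: near_eq_derivable.
- exact: near_eq_derivable dg.
- rewrite -(nbhs_singleton gg); apply: cvg_trans fg; apply: near_eq_cvg.
  by apply: filterS ff => i /nbhs_singleton.
- rewrite -(near_eq_derive _ gg); apply: cvg_trans Dfg; apply: near_eq_cvg.
  by apply: filterS ff => i /(near_eq_derive v).
Qed.

Lemma C1cvg_cst g : derivable g x v -> C1cvg (fun=> g) g.
Proof.
by move=> dg; split; [exact: nearW|by []|exact: cvg_cst|exact: cvg_cst].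
Qed.

Lemma C1cvg_scalar (c : I -> R) (l : R) :
  c @ F --> l -> C1cvg (fun i _ => c i) (fun=> l).
Proof.
move=> cl; split.
- by apply: nearW => i; exact: derivable_cst.
- exact: derivable_cst.
- exact: cl.
- rewrite derive_cst; under eq_cvg do rewrite derive_cst; exact: cvg_cst.
Qed.

Lemma C1cvgD f1 f2 g1 g2 : C1cvg f1 g1 -> C1cvg f2 g2 ->
  C1cvg (fun i y => f1 i y + f2 i y) (fun y => g1 y + g2 y).
Proof.
move=> [df1 dg1 fg1 Dfg1] [df2 dg2 fg2 Dfg2]; split.
- by apply: filterS2 df1 df2 => i; exact: derivableD.
- exact: derivableD.
- exact: cvgD.
- have -> : 'D_v (fun y => g1 y + g2 y) x = 'D_v g1 x + 'D_v g2 x.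
    exact: deriveD.
  apply: cvg_trans (cvgD Dfg1 Dfg2).
  by apply: near_eq_cvg; apply: filterS2 df1 df2 => i d1 d2; exact/esym/deriveD.
Qed.

Lemma C1cvgM f1 f2 g1 g2 : C1cvg f1 g1 -> C1cvg f2 g2 ->
  C1cvg (fun i y => f1 i y * f2 i y) (fun y => g1 y * g2 y).
Proof.
move=> [df1 dg1 fg1 Dfg1] [df2 dg2 fg2 Dfg2]; split.
- by apply: filterS2 df1 df2 => i; exact: derivableM.
- exact: derivableM.
- exact: cvgM.
- have -> : 'D_v (fun y => g1 y * g2 y) x = g1 x * 'D_v g2 x + g2 x * 'D_v g1 x.
    exact: deriveM.
  apply: cvg_trans (cvgD (cvgM fg1 Dfg2) (cvgM fg2 Dfg1)).
  by apply: near_eq_cvg; apply: filterS2 df1 df2 => i d1 d2; exact/esym/deriveM.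
Qed.

Lemma C1cvgZ (c : R) f g : C1cvg f g ->
  C1cvg (fun i y => c * f i y) (fun y => c * g y).
Proof. by apply: C1cvgM; apply: C1cvg_scalar; exact: cvg_cst. Qed.

Lemma C1cvgV f g : g x != 0 -> C1cvg f g ->
  C1cvg (fun i y => (f i y)^-1) (fun y => (g y)^-1).
Proof.
move=> g0 [df dg fg Dfg].
have f0 : \forall i \near F, f i x != 0 by exact: cvgr_neq0 fg g0.
split.
- by apply: filterS2 df f0 => i d0 d1; exact: derivableV.
- exact: derivableV.
- exact: cvgV.
- rewrite deriveV//.
  apply: cvg_trans (cvgM (cvgN (cvgV (expf_neq0 2 g0) (cvgM fg fg))) Dfg).
  by apply: near_eq_cvg; apply: filterS2 df f0 => i d0 d1; rewrite deriveV.
Qed.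

Lemma C1cvg_sum n (f : 'I_n -> I -> V -> R) (g : 'I_n -> V -> R) :
  (forall k, C1cvg (f k) (g k)) ->
  C1cvg (fun i y => \sum_k f k i y) (fun y => \sum_k g k y).
Proof.
elim: n f g => [|n IH] f g fg.
  apply: (@C1cvg_congr (fun _ => cst 0) _ (cst 0)); last 1 first.
  - by apply: C1cvg_cst; exact: derivable_cst.
  - by apply: nearW => i; apply: nearW => y; rewrite big_ord0.
  - by apply: nearW => y; rewrite big_ord0.
apply: C1cvg_congr (C1cvgD (fg ord0) (IH _ _ (fun k => fg (lift ord0 k)))).
- by apply: nearW => i; apply: nearW => y; rewrite big_ord_recl.
- by apply: nearW => y; rewrite big_ord_recl.
Qed.

(** Removes the [eps] and [eps ^+ 2] terms of the expansions: their
coefficients need only converge. *)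
Lemma C1cvg_small (c : I -> R) f g : c @ F --> 0 -> C1cvg f g ->
  C1cvg (fun i y => c i * f i y) (fun=> 0).
Proof.
move=> c0 fg; apply: C1cvg_congr (C1cvgM (C1cvg_scalar c0) fg).
- by apply: nearW => i; exact: nearW.
- by apply: nearW => y; rewrite mul0r.
Qed.

End C1Convergence.

Lemma cvg_dive {R : realType} {d : nat} {I : Type} (F : set_system I)
    {FF : ProperFilter F} (f : I -> 'rV[R]_d -> 'rV[R]_d)
    (g : 'rV[R]_d -> 'rV[R]_d) x :
  (forall i, C1cvg F x (delta_mx 0 i)
     (fun e y => f e y 0 i) (fun y => g y 0 i)) ->
  dive (f e) x @[e --> F] --> dive g x.
Proof.
move=> fg; apply: cvg_big; first exact: add_continuous.
by move=> i _; have [] := fg i.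
Qed.

Lemma cvg_dot {R : realType} {d : nat} {I : Type} (F : set_system I)
    {FF : ProperFilter F} (f g : I -> 'rV[R]_d)
    (a b : 'rV[R]_d) :
  (forall i, f e 0 i @[e --> F] --> a 0 i) ->
  (forall i, g e 0 i @[e --> F] --> b 0 i) ->
  dot (f e) (g e) @[e --> F] --> dot a b.
Proof.
move=> fa gb; apply: cvg_big; first exact: add_continuous.
by move=> i _; exact: cvgM.
Qed.

Lemma outerE {R : realType} {d : nat} (u w : 'rV[R]_d) i j :
  outer u w i j = u 0 i * w 0 j.
Proof. by rewrite mxE big_ord1 !mxE. Qed.

Lemma divT_outer {R : realType} {d : nat} (r : 'rV[R]_d -> R)
    (u : 'rV[R]_d -> 'rV[R]_d) x j :
  divT (fun y => r y *: outer (u y) (u y)) x 0 j =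
  \sum_i partial i (fun y => r y * (u y 0 i * u y 0 j)) x.
Proof.
rewrite mxE; apply: eq_bigr => i _; congr (partial i _ x); apply/funext => y.
by rewrite mxE outerE.
Qed.

Lemma divT_outer_pressure {R : realType} {d : nat} (r q : 'rV[R]_d -> R)
    (u : 'rV[R]_d -> 'rV[R]_d) x j :
  (forall i, derivable (fun y => r y * (u y 0 i * u y 0 j)) x (delta_mx 0 i)) ->
  derivable q x (delta_mx 0 j) ->
  divT (fun y => r y *: outer (u y) (u y) + (q y)%:M) x 0 j =
  \sum_i partial i (fun y => r y * (u y 0 i * u y 0 j)) x + partial j q x.
Proof.
move=> dr dq; rewrite mxE [in RHS](bigD1 j)//= [in LHS](bigD1 j)//= addrAC.
congr (_ + _).
  rewrite -[RHS](deriveD (dr j) dq); congr ('D__ _ x); apply/funext => y.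
  by rewrite mxE [X in X + _]mxE outerE [X in _ + X]mxE eqxx mulr1n.
apply: eq_bigr => i ij; congr (partial i _ x); apply/funext => y.
by rewrite mxE [X in X + _]mxE outerE [X in _ + X]mxE (negbTE ij) mulr0n addr0.
Qed.

(** * Letting the Mach number tend to zero *)

Section Coefficients.
Context {R : realType} {d : nat}.
Local Notation V := 'rV[R]_d.

Lemma near_eps01 : \forall e \near (0 : R)^'+, 0 < e <= 1.
Proof.
near=> e; apply/andP; split; near: e; first exact: nbhs_right_gt.
exact: nbhs_right_le.
Unshelve. all: by end_near. Qed.

Lemma near_limit_eq (f g : R -> R) (a b : R) :
  (\forall e \near 0^'+, f e = g e) ->
  f e @[e --> 0^'+] --> a -> g e @[e --> 0^'+] --> b -> a = b.
Proof.
move=> fg fa gb; apply: (cvg_unique _ fa); first exact: norm_hausdorff.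
apply: cvg_trans gb; apply: near_eq_cvg.
by apply: filterS fg => e ->.
Qed.

Lemma eps_limit_eq (f g : R -> R) (a b : R) :
  (forall e, 0 < e <= 1 -> f e = g e) ->
  f e @[e --> 0^'+] --> a -> g e @[e --> 0^'+] --> b -> a = b.
Proof.
by move=> fg; apply: near_limit_eq; apply: filterS near_eps01 => e /fg.
Qed.

Lemma coeff_cvg_C1 (O : set V) (f : R -> V -> R) g x v :
  O x -> coeff_cvg O f g -> C1cvg 0^'+ x v f g.
Proof.
move=> Ox [df [dg fg]]; split.
- by apply: filterS near_eps01 => e /df /(_ [::] x Ox)/= /diff_derivable.
- by have /(_ [::] x Ox)/= /diff_derivable := dg.
- by have [_] := fg [::] x Ox.
- by have [_] := fg [:: v] x Ox.
Qed.

Lemma coeff_cvg_coord_C1 (O : set V) (f : R -> V -> V) g x v i :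
  O x -> coeff_cvg O f g ->
  C1cvg 0^'+ x v (fun e y => f e y 0 i) (fun y => g y 0 i).
Proof.
move=> Ox [df [dg fg]].
have Df : \forall e \near 0^'+, derivable (f e) x v.
  by apply: filterS near_eps01 => e /df /(_ [::] x Ox)/= /diff_derivable.
have Dg : derivable g x v by apply: diff_derivable; exact: (dg [::]).
have coord (h : V -> V) : derivable h x v ->
    'D_v (fun y => h y 0 i) x = ('D_v h x) 0 i.
  by move=> dh; rewrite derive_mx// mxE.
split.
- by apply: filterS Df => e /derivable_mxP.
- by have /derivable_mxP := Dg.
- have [_] := fg [::] x Ox.
  by move=> /(cvg_comp _ _)/(_ (@coord_continuous _ _ _ 0 i _)).
- rewrite coord//; have [_] := fg [:: v] x Ox.
  move=> /(cvg_comp _ _)/(_ (@coord_continuous _ _ _ 0 i _)).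
  apply: cvg_trans; apply: near_eq_cvg.
  by apply: filterS Df => e /coord.
Qed.

End Coefficients.

(** * The hydrostatic background *)

Section Background.
Context {R : realType} {d : nat} {gamma : R} {B : background R d}.
Context (gamma_gt1 : 1 < gamma).
Context (backgroundB : is_background gamma B).
Context (theta0_const : exists c : R, forall x, Omega B x -> theta0 B x = c).

Lemma near_Omega x : Omega B x -> \forall y \near x, Omega B y.
Proof. by move=> Ox; apply: open_nbhs_nbhs; split=> //; case: backgroundB. Qed.

Lemma rho0_gt0 x : Omega B x -> 0 < rho0 B x.
Proof. by move=> Ox; have [_ [_ [_ [_ [_ /(_ x Ox)[]]]]]] := backgroundB. Qed.

Lemma theta0_gt0 x : Omega B x -> 0 < theta0 B x.
Proof. by move=> Ox; have [_ [_ [_ [_ [_ /(_ x Ox)[_ []]]]]]] := backgroundB. Qed.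

Lemma differentiable_rho0 x : Omega B x -> differentiable (rho0 B) x.
Proof. by move=> Ox; have [_ [_ [/(_ [::] x Ox)]]] := backgroundB. Qed.

Lemma differentiable_p0 x : Omega B x -> differentiable (p0 B) x.
Proof. by move=> Ox; have [_ [_ [_ [/(_ [::] x Ox)]]]] := backgroundB. Qed.

Lemma partial_p0 i x : Omega B x ->
  partial i (p0 B) x = - rho0 B x * partial i (Phi B) x.
Proof.
move=> Ox; have [_ [_ [_ [_ [_ /(_ x Ox)[_ [_ [_]]]]]]]] := backgroundB.
by move=> /rowP/(_ i); rewrite !mxE.
Qed.

Lemma grad_theta0 x : Omega B x -> grad (theta0 B) x = 0.
Proof.
move=> Ox; have [c thetac] := theta0_const; apply/rowP => i; rewrite !mxE.
rewrite /partial (@near_eq_derive _ _ _ _ (cst c)) ?derive_cst//.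
by apply: filterS (near_Omega Ox) => y /thetac.
Qed.

(** Logarithmic derivative of [p0 = (rho0 * c) `^ gamma], where [c] is the
constant value of [theta0], with denominators cleared. *)
Lemma derive_p0 x v : Omega B x ->
  rho0 B x * 'D_v (p0 B) x = gamma * p0 B x * 'D_v (rho0 B) x.
Proof.
move=> Ox; have [c thetac] := theta0_const.
have r0 := rho0_gt0 Ox; have t0 := theta0_gt0 Ox.
have drho := differentiable_rho0 Ox.
pose w y := rho0 B y * c.
have w0 : 0 < w x by rewrite mulr_gt0// -(thetac x).
have dw : is_derive x v w (c * 'D_v (rho0 B) x).
  have := @is_deriveM _ _ (rho0 B) (cst c) x v _ _
    (derivableP (diff_derivable drho)) (is_derive_cst c x v).
  by rewrite scaler0 add0r.
have diffw : differentiable w x by apply: differentiableM.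
have dpow : differentiable (fun t : R => t `^ gamma) (w x).
  by apply/derivable1_diffP; have [] := is_derive1_powR gamma w0.
have p0E : \forall y \near x, p0 B y = ((fun t : R => t `^ gamma) \o w) y.
  apply: filterS (near_Omega Ox) => y Oy; rewrite /= /w -(thetac y)//.
  by have [_ [_ [_ [_ [_ /(_ y Oy)[_ [_ []]]]]]]] := backgroundB.
rewrite (near_eq_derive _ p0E) deriveE; last exact: differentiable_comp.
rewrite diff_comp//= -(deriveE _ diffw) (@derive_val _ _ _ _ _ _ _ dw).
rewrite diff1E//= derive1E.
have [_ ->] := is_derive1_powR gamma w0.
rewrite (nbhs_singleton p0E) /= powRB ?gt_eqF ?implybT// powRr1 ?ltW//.
set P := _ `^ _; rewrite /w -[_ *: _]/(_ * _).
have c0 : c != 0 by rewrite -(thetac x)// gt_eqF.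
by field; rewrite c0 gt_eqF.
Qed.

(** In terms of [p0] and its derivative only: by [derive_p0] the contribution of
the derivative of [rho0] is the fraction [1 / gamma] of that of [p0], and
[gamma / (gamma - 1) * (1 - 1 / gamma) = 1]. *)
Lemma derive_enthalpy0 x v : Omega B x ->
  'D_v (fun y => gamma / (gamma - 1) * (p0 B y * (rho0 B y)^-1)) x =
  (rho0 B x)^-1 * 'D_v (p0 B) x.
Proof.
move=> Ox; have r0 := rho0_gt0 Ox; have rn0 : rho0 B x != 0 by rewrite gt_eqF.
have dr : derivable (rho0 B) x v by exact/diff_derivable/differentiable_rho0.
have dp : derivable (p0 B) x v by exact/diff_derivable/differentiable_p0.
have drV := derivableV rn0 dr.
rewrite (deriveZ (gamma / (gamma - 1)) (derivableM dp drV)).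
rewrite (deriveM dp drV) deriveV//.
rewrite -![_ *: _]/(_ * _).
have Dp := derive_p0 v Ox.
set a := 'D_v (p0 B) x in Dp *; set b := 'D_v (rho0 B) x in Dp *.
have -> : a = gamma * p0 B x * b / rho0 B x by rewrite -Dp; field.
have g0 : gamma - 1 != 0 by rewrite subr_eq0 gt_eqF.
by field; rewrite g0 rn0.
Qed.

End Background.

(** * The limiting scheme *)

Section LimitingScheme.
Context {R : realType} {d : nat} {gamma : R} {B : background R d}.
Context (gamma_gt1 : 1 < gamma).
Context (backgroundB : is_background gamma B).
Context (theta0_const : exists c : R, forall x, Omega B x -> theta0 B x = c).
Context {dt : R} {S : R -> run R d} {C : R -> coeffs R d}
  {L : nat -> limstate R d}.
Context (dt_gt0 : 0 < dt).
Context (schemeS : forall eps, 0 < eps <= 1 ->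
  imex_scheme gamma eps dt B (S eps)).
Context (preparedS : forall eps, 0 < eps <= 1 ->
  well_prepared gamma eps B (S eps) (C eps)).
Context (expansionS : forall eps, 0 < eps <= 1 ->
  forall n, (1 <= n)%N -> expansion eps B (S eps) (C eps) n).
Context (densityS : forall eps, 0 < eps <= 1 ->
  new_level_density eps B (S eps)).
Context (limitS : limit_coeffs B S C L).

Local Notation O := (Omega B).
Local Notation V := 'rV[R]_d.
Local Notation C1 := (C1cvg (0 : R)^'+).

Lemma C1cvg_Omega (f f' : R -> V -> R) (g g' : V -> R) x v : O x ->
  (forall e y, 0 < e <= 1 -> O y -> f e y = f' e y) ->
  (forall y, O y -> g y = g' y) -> C1 x v f g -> C1 x v f' g'.
Proof.
move=> Ox ff gg; have Onear := near_Omega backgroundB Ox; apply: C1cvg_congr.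
  apply: filterS near_eps01 => e e01; apply: filterS Onear => y; exact: ff.
by apply: filterS Onear => y; exact: gg.
Qed.

Lemma eps_cvg0 : (fun e : R => e) @ (0 : R)^'+ --> (0 : R).
Proof. exact: cvg_at_right_filter. Qed.

Lemma eps2_cvg0 : (fun e : R => e ^+ 2) @ (0 : R)^'+ --> (0 : R).
Proof.
have -> : (fun e : R => e ^+ 2) = (fun e => e * e) by apply/funext => e.
rewrite -[X in _ --> X](mulr0 0); exact: cvgM eps_cvg0 eps_cvg0.
Qed.

Lemma expansionS0 e n : 0 < e <= 1 -> expansion e B (S e) (C e) n.
Proof.
by move=> e01; case: n => [|n]; [case: (preparedS e01)|exact: expansionS].
Qed.

(** At the initial level this is the well-prepared expansion, at later levels
the prescribed form of the new density. *)
Lemma rhoE e n y : 0 < e <= 1 -> O y ->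
  rho (S e) n y = rho_imp e B (S e) n y.
Proof.
move=> e01 Oy; case: n => [|n]; last exact: densityS.
have [ex /(_ y Oy)[_ [_ [r0 _]]]] := preparedS e01.
by have [-> _] := ex y Oy; rewrite r0.
Qed.

Lemma rhocoef0E e n y : 0 < e <= 1 -> O y -> rhocoef0 (C e) n y = rho0 B y.
Proof.
move=> e01 Oy; have [+ _] := expansionS0 n e01 Oy.
by rewrite rhoE// /rho_imp => /addIr.
Qed.

Lemma lrho0E n x : O x -> lrho0 (L n) x = rho0 B x.
Proof.
move=> Ox; have [lr _] := limitS n.
have [_ _ cr _] := coeff_cvg_C1 0 Ox lr.
apply: (eps_limit_eq _ cr (cvg_cst _)) => e e01.
exact: rhocoef0E.
Qed.

Lemma C1_rho_imp n x v : O x ->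
  C1 x v (fun e => rho_imp e B (S e) n) (rho0 B).
Proof.
move=> Ox; have [_ [_ [_ [lr2 _]]]] := limitS n.
have dr : derivable (rho0 B) x v.
  exact: diff_derivable (differentiable_rho0 backgroundB Ox).
apply: (C1cvg_Omega Ox _ _ (C1cvgD (C1cvg_cst dr)
  (C1cvg_small eps2_cvg0 (coeff_cvg_C1 v Ox lr2)))) => //.
by move=> y _; rewrite addr0.
Qed.

Lemma C1_p_imp n x v : O x -> C1 x v (fun e => p_imp e B (S e) n) (p0 B).
Proof.
move=> Ox; have [_ [_ [_ [_ [lp2 _]]]]] := limitS n.
have dp : derivable (p0 B) x v.
  exact: diff_derivable (differentiable_p0 backgroundB Ox).
apply: (C1cvg_Omega Ox _ _ (C1cvgD (C1cvg_cst dp)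
  (C1cvg_small eps2_cvg0 (coeff_cvg_C1 v Ox lp2)))) => //.
by move=> y _; rewrite addr0.
Qed.

Lemma C1_rho n x v : O x -> C1 x v (fun e => rho (S e) n) (rho0 B).
Proof.
move=> Ox; apply: (C1cvg_Omega Ox _ _ (C1_rho_imp n v Ox)) => // e y e01 Oy.
by rewrite rhoE.
Qed.

Lemma C1_mom n i x v : O x ->
  C1 x v (fun e y => mom (S e) n y 0 i) (fun y => lmom0 (L n) y 0 i).
Proof.
move=> Ox; have [_ [lm0 [_ [_ [_ [_ [[m1 lm1] _]]]]]]] := limitS n.
apply: (C1cvg_Omega Ox _ _ (C1cvgD (coeff_cvg_coord_C1 v i Ox lm0)
  (C1cvg_small eps_cvg0 (coeff_cvg_coord_C1 v i Ox lm1)))) => //.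
  move=> e y e01 Oy; have [_ [-> _]] := expansionS0 n e01 Oy.
  by rewrite !mxE.
by move=> y _; rewrite addr0.
Qed.

Lemma C1_p n x v : O x -> C1 x v (fun e => p (S e) n) (lp0 (L n)).
Proof.
move=> Ox; have [_ [_ [lp [_ [_ [_ [_ [q2 lq2]]]]]]]] := limitS n.
apply: (C1cvg_Omega Ox _ _ (C1cvgD (coeff_cvg_C1 v Ox lp)
  (C1cvg_small eps2_cvg0 (coeff_cvg_C1 v Ox lq2)))) => //.
  by move=> e y e01 Oy; have [_ [_ ->]] := expansionS0 n e01 Oy.
by move=> y _; rewrite addr0.
Qed.

Lemma C1_vel n i x v : O x ->
  C1 x v (fun e y => vel (S e) n y 0 i) (fun y => lvel (L n) y 0 i).
Proof.
move=> Ox; have rn0 : rho0 B x != 0 by rewrite gt_eqF// (rho0_gt0 backgroundB).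
apply: (C1cvg_Omega Ox _ _ (C1cvgM (C1cvgV rn0 (C1_rho n v Ox))
  (C1_mom n i v Ox))) => //.
  by move=> e y _ _; rewrite !mxE.
by move=> y Oy; rewrite !mxE lrho0E.
Qed.

Lemma C1_E n x v : O x ->
  C1 x v (fun e => E (S e) n) (fun y => lp0 (L n) y / (gamma - 1)).
Proof.
move=> Ox; have cvel i := C1_vel n i v Ox.
have cdot : C1 x v (fun e y => dot (vel (S e) n y) (vel (S e) n y))
    (fun y => dot (lvel (L n) y) (lvel (L n) y)).
  by apply: C1cvg_sum => i; exact: C1cvgM.
pose proof (C1cvg_small eps2_cvg0 (C1cvgM (C1_rho n v Ox) cdot)) as ckin.
pose proof (C1cvgZ (gamma - 1)^-1 (C1_p n v Ox)) as cpr.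
apply: (C1cvg_Omega Ox _ _ (C1cvgD (C1cvgZ 2^-1 ckin) cpr)).
  move=> e y e01 Oy; have [_ [-> _]] := schemeS e01 n Oy.
  by rewrite !mulrA [_ / _]mulrC.
by move=> y _; rewrite mulr0 add0r mulrC.
Qed.

Lemma one_sub_eps2_cvg1 : (1 - e ^+ 2) @[e --> (0 : R)^'+] --> (1 : R).
Proof.
rewrite -[X in _ --> X]subr0; apply: cvgB; [exact: cvg_cst|exact: eps2_cvg0].
Qed.

Lemma cvg_dive_mom n x : O x ->
  dive (mom (S e) n) x @[e --> (0 : R)^'+] --> dive (lmom0 (L n)) x.
Proof. by move=> Ox; apply: cvg_dive => i; exact: C1_mom. Qed.

(** Both densities differ from [rho0] by [eps ^+ 2] times a bounded field, so the
mass equation retains only the implicit divergence. *)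
Lemma dive_lmom0 n x : O x -> dive (lmom0 (L n.+1)) x = 0.
Proof.
move=> Ox; have [_ _ r0 _] := C1_rho n 0 Ox.
have [_ _ r1 _] := C1_rho n.+1 0 Ox.
pose proof (cvgD (cvgD (cvgM (cvgB r1 r0) (cvg_cst dt^-1))
  (cvgM eps2_cvg0 (cvg_dive_mom (n := n) Ox)))
  (cvgM one_sub_eps2_cvg1 (cvg_dive_mom (n := n.+1) Ox))) as lhs.
have := eps_limit_eq (g := fun=> 0) _ lhs (cvg_cst 0).
rewrite subrr !mul0r !add0r mul1r; apply=> e e01.
by have [_ [_ []]] := schemeS e01 n Ox.
Qed.

Definition enthalpy0 (y : V) : R :=
  gamma / (gamma - 1) * (p0 B y * (rho0 B y)^-1).

Lemma C1_enthalpy n x v : O x ->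
  C1 x v (fun e => enthalpy_imp gamma e B (S e) n) enthalpy0.
Proof.
move=> Ox; have rn0 : rho0 B x != 0 by rewrite gt_eqF// (rho0_gt0 backgroundB).
pose proof (C1cvgV rn0 (C1_rho_imp n v Ox)) as crV.
have cdot : C1 x v (fun e y => dot (mom (S e) n y) (mom (S e) n y))
    (fun y => dot (lmom0 (L n) y) (lmom0 (L n) y)).
  by apply: C1cvg_sum => i; apply: C1cvgM; exact: C1_mom.
pose proof (C1cvg_small eps2_cvg0 (C1cvgM cdot (C1cvgM crV crV))) as ckin.
pose proof (C1cvgZ (gamma / (gamma - 1)) (C1cvgM (C1_p_imp n v Ox) crV)) as cpr.
apply: (C1cvg_Omega Ox _ _ (C1cvgD cpr (C1cvgZ 2^-1 ckin))).
  move=> e y _ _.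
  by rewrite /enthalpy_imp [rho_imp _ _ _ _ _ ^+ 2]expr2 invfM !mulrA.
by move=> y _; rewrite mulr0 addr0.
Qed.

(** In the limit the enthalpy flux exactly balances the work of gravity:
[grad enthalpy0] is [grad p0 / rho0 = - grad Phi], and the momentum is
divergence-free. *)
Lemma dive_enthalpy0_lmom0 n x : O x ->
  dive (fun y => enthalpy0 y *: lmom0 (L n.+1) y) x =
  - dot (lmom0 (L n.+1) x) (grad (Phi B) x).
Proof.
move=> Ox; have rn0 : rho0 B x != 0 by rewrite gt_eqF// (rho0_gt0 backgroundB).
rewrite -[RHS](addr0) -[X in _ + X](mulr0 (enthalpy0 x)) -(dive_lmom0 n Ox).
rewrite /dive /dot mulr_sumr -sumrN -big_split/=; apply: eq_bigr => i _.
rewrite /partial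
  (_ : (fun y => _) = fun y => enthalpy0 y * lmom0 (L n.+1) y 0 i);
  last by apply/funext => y; rewrite mxE.
have [_ dH _ _] := C1_enthalpy n.+1 (delta_mx 0 i) Ox.
have [_ dm _ _] := C1_mom n.+1 i (delta_mx 0 i) Ox.
rewrite [LHS](deriveM dH dm) derive_enthalpy0//.
have := partial_p0 backgroundB i Ox; rewrite /partial => ->.
rewrite !mxE -![_ *: _]/(_ * _) addrC; congr (_ + _).
by rewrite /partial; field.
Qed.

(** At a new level the equation-of-state pressure is governed by the energy
equation alone, so its limit is found by induction on the level:
[dive_enthalpy0_lmom0] makes the energy increment vanish in the limit. *)
Lemma lp0E n x : O x -> lp0 (L n) x = p0 B x.
Proof.
move=> Ox; elim: n => [|n IH].
  have [_ _ cp _] := C1_p 0 0 Ox.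
  have [_ _ cp0 _] := coeff_cvg_C1 0 Ox (limitS 0%N).2.2.1.
  apply: (eps_limit_eq _ cp0 (cvg_cst _)) => e e01.
  by have [_ /(_ x Ox)[_ [_ [_ [-> _]]]]] := preparedS e01.
have [_ _ E0 _] := C1_E n 0 Ox; have [_ _ E1 _] := C1_E n.+1 0 Ox.
have cgrad m : dot (mom (S e) m x) (grad (Phi B) x) @[e --> (0 : R)^'+] -->
    dot (lmom0 (L m) x) (grad (Phi B) x).
  apply: cvg_dot => i; last exact: cvg_cst.
  by have [] := C1_mom m i 0 Ox.
have cflux0 : dive (fun y => (E (S e) n y + p (S e) n y) *: vel (S e) n y) x
    @[e --> (0 : R)^'+] -->
    dive (fun y => (lp0 (L n) y / (gamma - 1) + lp0 (L n) y) *: lvel (L n) y) x.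
  apply: cvg_dive => i.
  apply: (C1cvg_Omega Ox _ _ (C1cvgM (C1cvgD (C1_E n _ Ox) (C1_p n _ Ox))
    (C1_vel n i _ Ox))) => [e y _ _|y _]; by rewrite !mxE.
have cflux1 : dive (fun y => enthalpy_imp gamma e B (S e) n.+1 y *:
    mom (S e) n.+1 y) x @[e --> (0 : R)^'+] -->
    dive (fun y => enthalpy0 y *: lmom0 (L n.+1) y) x.
  apply: cvg_dive => i.
  apply: (C1cvg_Omega Ox _ _ (C1cvgM (C1_enthalpy n.+1 _ Ox)
    (C1_mom n.+1 i _ Ox))) => [e y _ _|y _]; by rewrite !mxE.
pose proof (cvgD (cvgD (cvgM (cvgB E1 E0) (cvg_cst dt^-1))
  (cvgM eps2_cvg0 cflux0)) (cvgM one_sub_eps2_cvg1 cflux1)) as lhs.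
pose proof (cvgB (cvgN (cvgM eps2_cvg0 (cgrad n)))
  (cvgM one_sub_eps2_cvg1 (cgrad n.+1))) as rhs.
have step e (e01 : 0 < e <= 1) := (schemeS e01 n Ox).2.2.2.2.1.
have := eps_limit_eq _ lhs rhs; move=> /(_ step).
rewrite dive_enthalpy0_lmom0// !mul0r !mul1r oppr0 addr0 => /addIr.
have g0 : gamma - 1 != 0 by rewrite subr_eq0 gt_eqF.
rewrite -mulrBl IH => /eqP; rewrite !mulf_eq0 !invr_eq0 (negbTE g0).
by rewrite (gt_eqF dt_gt0) !orbF subr_eq0 => /eqP.
Qed.

Lemma lp2E n x : O x ->
  lp2 (L n.+1) x = closure_p2 gamma B (lrho2 (L n.+1)) (ltheta2 (L n.+1)) x.
Proof.
move=> Ox; have [_ [_ [_ [cr2 [cp2 [ct2 _]]]]]] := limitS n.+1.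
have [_ _ r2 _] := coeff_cvg_C1 0 Ox cr2.
have [_ _ q2 _] := coeff_cvg_C1 0 Ox cp2.
have [_ _ t2 _] := coeff_cvg_C1 0 Ox ct2.
have th : theta e B (S e) n.+1 x @[e --> (0 : R)^'+] --> theta0 B x.
  rewrite -[X in _ --> X]addr0 -[X in _ + X](mul0r (ltheta2 (L n.+1) x)).
  by apply: cvgD; [exact: cvg_cst|exact: cvgM eps2_cvg0 t2].
pose proof (cvgM (cvg_cst (gamma * p0 B x / (rho0 B x * theta0 B x)))
  (cvgD (cvgM (cvg_cst (rho0 B x)) t2) (cvgM r2 th))) as rhs.
have step e (e01 : 0 < e <= 1) := (schemeS e01 n Ox).2.2.2.2.2.2.2.
have := eps_limit_eq _ q2 rhs; move=> /(_ step) ->.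
by rewrite /closure_p2 [lrho2 _ _ * _]mulrC.
Qed.

Lemma limit_theta n x : O x ->
  (ltheta2 (L n.+1) x - ltheta2 (L n) x) / dt
  + dot (lvel (L n) x) (grad (ltheta2 (L n)) x) = 0.
Proof.
move=> Ox; have [_ [_ [_ [_ [_ [ct2 _]]]]]] := limitS n.
have [_ [_ [_ [_ [_ [ct2' _]]]]]] := limitS n.+1.
have [_ _ t2 _] := coeff_cvg_C1 0 Ox ct2.
have [_ _ t2' _] := coeff_cvg_C1 0 Ox ct2'.
have cdot : dot (vel (S e) n x) (grad (theta2 (S e) n) x) @[e --> (0 : R)^'+]
    --> dot (lvel (L n) x) (grad (ltheta2 (L n)) x).
  apply: cvg_dot => i; first by have [] := C1_vel n i 0 Ox.
  rewrite mxE; under eq_cvg do rewrite mxE.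
  by have [] := coeff_cvg_C1 (delta_mx 0 i) Ox ct2.
pose proof (cvgD (cvgM (cvgB t2' t2) (cvg_cst dt^-1)) cdot) as lhs.
apply: (eps_limit_eq _ lhs (cvg_cst 0)) => e e01.
have := (schemeS e01 n Ox).2.2.2.2.2.1.
rewrite /eq_S4 (grad_theta0 backgroundB)//.
move=> <-; rewrite [dot _ 0]big1 ?mulr0 ?addr0// => i _.
by rewrite [X in _ * X]mxE mulr0.
Qed.

(** For each [eps], the hydrostatic balance removes the factor [eps ^- 2] and
leaves the regular identity [step] below, whose limit still contains the old
pressure gradient and weight; these cancel because [lp0] is [p0]. *)
Lemma limit_momentum n x : O x ->
  dt^-1 *: (lmom0 (L n.+1) x - lmom0 (L n) x)
  + divT (fun y => lrho0 (L n) y *: outer (lvel (L n) y) (lvel (L n) y)) x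
  + grad (lp2 (L n.+1)) x + lrho2 (L n.+1) x *: grad (Phi B) x = 0.
Proof.
move=> Ox; apply/rowP => j.
have := divT_outer (lrho0 (L n)) (lvel (L n)) x j.
move: (divT _ x) => T TE; rewrite !mxE {T}TE.
have [_ [_ [_ [cr2 [cp2 _]]]]] := limitS n.+1.
have [_ _ r2 _] := coeff_cvg_C1 0 Ox cr2.
have [dp2 _ _ Dp2] := coeff_cvg_C1 (delta_mx 0 j) Ox cp2.
have [_ _ m0 _] := C1_mom n j 0 Ox; have [_ _ m1 _] := C1_mom n.+1 j 0 Ox.
have [_ _ cr _] := C1_rho n 0 Ox.
have [dp _ _ Dp] := C1_p n (delta_mx 0 j) Ox.
have cflux i : C1 x (delta_mx 0 i) (fun e y => rho (S e) n y *
    (vel (S e) n y 0 i * vel (S e) n y 0 j))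
    (fun y => lrho0 (L n) y * (lvel (L n) y 0 i * lvel (L n) y 0 j)).
  apply: (C1cvg_Omega Ox _ _ (C1cvgM (C1_rho n _ Ox)
    (C1cvgM (C1_vel n i _ Ox) (C1_vel n j _ Ox)))) => // y Oy.
  by rewrite lrho0E.
have cdiv : \sum_i partial i (fun y => rho (S e) n y *
      (vel (S e) n y 0 i * vel (S e) n y 0 j)) x @[e --> (0 : R)^'+] -->
    \sum_i partial i (fun y => lrho0 (L n) y *
      (lvel (L n) y 0 i * lvel (L n) y 0 j)) x.
  apply: cvg_big; first exact: add_continuous.
  by move=> i _; have [] := cflux i.
pose proof (cvgD (cvgD (cvgM (cvg_cst dt^-1) (cvgB m1 m0))
  (cvgD cdiv Dp)) (cvgM one_sub_eps2_cvg1 Dp2)) as lhs.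
pose proof (cvgM (cvgN (cvgD cr (cvgM one_sub_eps2_cvg1 r2)))
  (cvg_cst (partial j (Phi B) x))) as rhs.
have := near_limit_eq _ lhs rhs; rewrite !mul1r.
have -> : 'D_(delta_mx 0 j) (lp0 (L n)) x = partial j (p0 B) x.
  apply: near_eq_derive.
  by apply: filterS (near_Omega backgroundB Ox) => y /lp0E.
rewrite (partial_p0 backgroundB)// => lim.
have dflux : \forall e \near (0 : R)^'+, forall i, derivable
    (fun y => rho (S e) n y * (vel (S e) n y 0 i * vel (S e) n y 0 j)) x
    (delta_mx 0 i).
  by apply: filter_forall => i; have [] := cflux i.
have step : \forall e \near (0 : R)^'+,
  dt^-1 * (mom (S e) n.+1 x 0 j - mom (S e) n x 0 j) +
    (\sum_i partial i (fun y => rho (S e) n y *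
      (vel (S e) n y 0 i * vel (S e) n y 0 j)) x + partial j (p (S e) n) x) +
    (1 - e ^+ 2) * partial j (p2 (S e) n.+1) x =
  - (rho (S e) n x + (1 - e ^+ 2) * rho2 (S e) n.+1 x) * partial j (Phi B) x.
  near=> e; have e01 : 0 < e <= 1 by near: e; exact: near_eps01.
  have e2 : e ^+ 2 != 0 by rewrite expf_neq0// gt_eqF//; case/andP: e01.
  have := (schemeS e01 n Ox).2.2.2.1; rewrite /eq_S2.
  have := @divT_outer_pressure _ _ (rho (S e) n) (p (S e) n) (vel (S e) n) x j.
  move: (divT _ x) => T TE /rowP/(_ j); rewrite !mxE {}TE; last 2 first.
  - by near: e.
  - by near: e.
  (* The background part of this gradient is - rho0 * partial j Phi; multiplied
     by the singular factor it cancels the background part of the weight. *)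
  have -> : partial j (p_imp e B (S e) n.+1) x =
      - rho0 B x * partial j (Phi B) x + e ^+ 2 * partial j (p2 (S e) n.+1) x.
    rewrite -(partial_p0 backgroundB)//.
    have dp0 : derivable (p0 B) x (delta_mx 0 j).
      exact/diff_derivable/(differentiable_p0 backgroundB).
    have dp2e : derivable (p2 (S e) n.+1) x (delta_mx 0 j) by near: e.
    by rewrite [LHS](deriveD dp0 (derivableZ (k := e ^+ 2) dp2e)) deriveZ.
  rewrite /rho_imp => /eqP; rewrite -subr_eq0 => /eqP H; apply/eqP.
  rewrite -subr_eq0; apply/eqP; rewrite -[RHS]H; field.
  by rewrite (gt_eqF dt_gt0) andbT gt_eqF//; case/andP: e01.
have := lim step.
rewrite /partial.
lra.
Unshelve. all: by end_near. Qed.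

Lemma limiting_step n :
  scheme_step B (limiting_scheme gamma B) dt (L n) (L n.+1).
Proof.
split=> /= x Ox; last by split; [exact: limit_momentum|exact: limit_theta].
split; first exact: lrho0E.
split; first exact: lp0E.
by split; [exact: dive_lmom0|exact: lp2E].
Qed.
End LimitingScheme.

(** * Consistency in time *)

Section TimeShift.
Context {R : realType} {V W : normedModType R}.
Implicit Types (z : R * V) (F : R * V -> W).

(** Differentiating in one variable at the other one frozen is differentiating
jointly along a coordinate direction: the two growth rates coincide, which
spares any appeal to a chain rule. *)
Lemma growth_time F z :
  (fun h : R => h^-1 *: (((fun s => F (s, z.2)) \o shift z.1) (h *: 1) - F z)) =
  (fun h : R => h^-1 *: ((F \o shift z) (h *: (1, 0)) - F z)).
Proof.
apply/funext => h; case: z => t x /=; congr (_ *: (F _ - _)).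
by congr pair; rewrite -[RHS]/(h *: 0 + x) scaler0 add0r.
Qed.

Lemma growth_space F z v :
  (fun h : R => h^-1 *: (((fun y => F (z.1, y)) \o shift z.2) (h *: v) - F z)) =
  (fun h : R => h^-1 *: ((F \o shift z) (h *: (0, v)) - F z)).
Proof.
apply/funext => h; case: z => t x /=; congr (_ *: (F _ - _)).
by congr pair; rewrite -[RHS]/(h *: 0 + t) scaler0 add0r.
Qed.

Lemma derive_time F z : 'D_1 (fun s => F (s, z.2)) z.1 = 'D_(1, 0) F z.
Proof. by rewrite /derive -growth_time; case: z. Qed.

Lemma derivable_time F z : derivable F z (1, 0) ->
  derivable (fun s => F (s, z.2)) z.1 1.
Proof. by rewrite /derivable -growth_time; case: z. Qed.

Lemma derive_space F z v :
  'D_v (fun y => F (z.1, y)) z.2 = 'D_(0, v) F z.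
Proof. by rewrite /derive -growth_space; case: z. Qed.

(** A local property still holds after short forward shifts in time, uniformly
with respect to the starting point.  With this form of uniformity the
consistency estimates can be proved pointwise and glued by compactness. *)
Lemma near_time_shift (P : R * V -> Prop) z0 : (\forall z \near z0, P z) ->
  \forall z \near z0 & h \near (0 : R)^'+,
    0 < h /\ forall c, 0 <= c <= h -> P (z.1 + c, z.2).
Proof.
move=> /nbhs_ballP[r /= r0 rP].
exists (ball z0 (r / 2), [set h | 0 < h < r / 2]) => /=.
  split; first by apply: nbhsx_ballx; rewrite divr_gt0.
  near=> h; apply/andP; split; near: h; first exact: nbhs_right_gt.
  by apply: nbhs_right_lt; rewrite divr_gt0.
move=> [z h] /= [[zt zx] /andP[h0 hr]]; split=> // c /andP[c0 ch].
apply: rP; split => /=.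
  rewrite /ball/= opprD addrA (le_lt_trans (ler_normB _ _))//.
  by rewrite [ltRHS](splitr r) ltrD// ger0_norm// (le_lt_trans ch).
apply: le_ball zx; rewrite ler_pdivrMr// mulr_natr mulr2n lerDl; exact: ltW.
Unshelve. all: by end_near. Qed.

End TimeShift.

Section DifferenceQuotient.
Context {R : realType} {V : normedModType R}.

Lemma near_time_increment (g : R * V -> R) z0 e : {for z0, continuous g} ->
  0 < e -> \forall z \near z0 & h \near (0 : R)^'+,
    `|g (z.1 + h, z.2) - g z| < e.
Proof.
move=> gc e0; have e20 : 0 < e / 2 by rewrite divr_gt0.
have : \forall z \near z0, `|g z0 - g z| < e / 2.
  by move/cvgrPdist_lt : gc; apply.
move=> /near_time_shift; apply: filterS => -[z h] /= [h0 sh].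
rewrite -(subrKA (g z0)) (le_lt_trans (ler_normD _ _))// (splitr e).
rewrite ltrD//; last first.
  by have := sh 0; rewrite lexx ltW// addr0 -surjective_pairing; apply.
by rewrite distrC sh// lexx ltW.
Qed.

(** By the mean value theorem the quotient equals [df] at an intermediate time;
that point and [z] are both close to [z0], where [df] is continuous. *)
Lemma near_difference_quotient (f : R -> V -> R) (df : R * V -> R)
    (z0 : R * V) e :
  (\forall z \near z0, is_derive z.1 (1 : R) (f ^~ z.2) (df z)) ->
  {for z0, continuous df} -> 0 < e ->
  \forall z \near z0 & h \near (0 : R)^'+,
    `|h^-1 * (f (z.1 + h) z.2 - f z.1 z.2) - df z| < e.
Proof.
move=> fdf dfc e0; have e20 : 0 < e / 2 by rewrite divr_gt0.
have dfe : \forall z \near z0, `|df z0 - df z| < e / 2.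
  by move/cvgrPdist_lt : dfc; apply.
have /near_time_shift : \forall z \near z0,
    is_derive z.1 (1 : R) (f ^~ z.2) (df z) /\ `|df z0 - df z| < e / 2.
  exact: filterI fdf dfe.
apply: filterS => -[[t x] h] /= [h0 sh].
have th : t < t + h by rewrite ltrDl.
have sub s : s \in `[t, t + h] -> is_derive s 1 (f ^~ x) (df (s, x)).
  rewrite in_itv/= => /andP[ts sh']; have [] := sh (s - t).
    by rewrite subr_ge0 ts lerBlDl.
  by rewrite addrC subrK.
have derivf s : s \in `]t, t + h[ -> is_derive s 1 (f ^~ x) (df (s, x)).
  by move=> sth; apply: sub; exact: subset_itv_oo_cc.
have contf : {within `[t, t + h], continuous (f ^~ x)}.
  by apply: derivable_within_continuous => s /sub[].
have [c cth fE] := MVT th derivf contf.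
have {fE}-> : f (t + h) x - f t x = df (c, x) * (t + h - t) by exact: fE.
rewrite addrAC subrr add0r mulrCA mulVf ?gt_eqF// mulr1.
rewrite -(subrKA (df z0)) (le_lt_trans (ler_normD _ _))// (splitr e).
rewrite ltrD//; last first.
  by have := (sh 0); rewrite lexx ltW// addr0 => /(_ isT)[].
rewrite distrC; move: cth; rewrite in_itv/= => /andP[tc ch].
have [] := sh (c - t); first by rewrite subr_ge0 ltW//= lerBlDl ltW.
by rewrite addrC subrK.
Qed.

End DifferenceQuotient.

Lemma ltr_rV_norm {R : realType} {d : nat} (v : 'rV[R]_d) e :
  0 < e -> (forall i, `|v 0 i| < e) -> `|v| < e.
Proof.
move=> e0 ve; rewrite [ltLHS]/Num.Def.normr/= mx_normrE.
by apply: bigmax_lt => // -[i j] _ /=; rewrite ord1.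
Qed.

Section Consistency.
Context {R : realType} {d : nat} {gamma : R} {B : background R d}.
Context (backgroundB : is_background gamma B).
Local Notation V := 'rV[R]_d.

Lemma continuous_partial_Phi i x : Omega B x ->
  {for x, continuous (partial i (Phi B))}.
Proof.
move=> Ox; have [_ [/(_ [:: delta_mx 0 i] x Ox) dP _]] := backgroundB.
exact: differentiable_continuous dP.
Qed.

Lemma open_spacetime T : open (spacetime B T).
Proof.
have -> : spacetime B T =
    (fst @^-1` [set t : R | 0 < t < T]) `&` (snd @^-1` Omega B) by [].
apply: openI; apply: open_comp.
- by move=> z _; exact: cvg_fst.
- rewrite (_ : mkset _ = [set` `]0, T[]); first exact: interval_open.
  by apply/seteqP; split=> t /=; rewrite in_itv.
- by move=> z _; exact: cvg_snd.
- by case: backgroundB.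
Qed.

Lemma near_spacetime T z : spacetime B T z ->
  \forall y \near z, spacetime B T y.
Proof.
by move=> Oz; apply: open_nbhs_nbhs; split=> //; exact: open_spacetime.
Qed.

Lemma lvel_state_of (u : V -> V) r2 q2 t2 y : Omega B y ->
  lvel (state_of B u r2 q2 t2) y = u y.
Proof.
move=> Oy; rewrite /lvel/= scalerA mulVf ?scale1r//.
by rewrite gt_eqF// (rho0_gt0 backgroundB).
Qed.

Context {T : R} {u : R -> V -> V} {r2 q2 t2 : R -> V -> R}.
Context (sol : limit_solution gamma B T u r2 q2 t2).
Local Notation Q := (spacetime B T).
Local Notation w t := (state_of B (u t) (r2 t) (q2 t) (t2 t)).
Let U (z : R * V) := u z.1 z.2.
Let q2' (z : R * V) := q2 z.1 z.2.
Let t2' (z : R * V) := t2 z.1 z.2.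

Let dtmom i (z : R * V) : R := rho0 B z.2 * ('D_(1, 0) U z) 0 i.
Let force i (z : R * V) : R :=
  'D_(0, delta_mx 0 i) q2' z + r2 z.1 z.2 * partial i (Phi B) z.2.

Lemma smooth_derive_continuous (W : normedModType R) (F : R * V -> W) z v :
  smooth_on Q F -> Q z -> {for z, continuous ('D_v F)}.
Proof.
by move=> sF Oz; apply: differentiable_continuous; exact: (sF [:: v]).
Qed.

Lemma continuous_dtmom i z : Q z -> {for z, continuous (dtmom i)}.
Proof.
move=> Oz; case: sol => sU _; have [_ Oz2] := Oz.
apply: cvgM.
  apply: (cvg_comp _ _ cvg_snd).
  exact: differentiable_continuous (differentiable_rho0 backgroundB Oz2).
have := smooth_derive_continuous (v := (1, 0)) sU Oz.
by move=> /(cvg_comp _ _)/(_ (@coord_continuous _ _ _ 0 i _)).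
Qed.

Lemma continuous_force i z : Q z -> {for z, continuous (force i)}.
Proof.
move=> Oz; case: sol => _ [sr2 [sq2 _]]; have [_ Oz2] := Oz.
apply: cvgD; first exact: smooth_derive_continuous.
apply: cvgM; first exact: differentiable_continuous (sr2 [::] z Oz).
apply: (cvg_comp _ _ cvg_snd); exact: continuous_partial_Phi.
Qed.

Lemma is_derive_velocity z : Q z ->
  is_derive z.1 (1 : R) (u ^~ z.2) ('D_(1, 0) U z).
Proof.
move=> Oz; case: sol => /(_ [::] z Oz) dU _.
have /derivable_time/derivableP : derivable U z (1, 0) by exact: diff_derivable.
by rewrite derive_time.
Qed.

Lemma is_derive_momentum i z : Q z ->
  is_derive z.1 (1 : R) (fun s => rho0 B z.2 * u s z.2 0 i) (dtmom i z).
Proof.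
move=> Oz; have [du Du] := is_derive_velocity Oz.
have dui : derivable (fun s => u s z.2 0 i) z.1 1 by have /derivable_mxP := du.
have := is_deriveZ (rho0 B z.2) (derivableP dui).
by have -> : 'D_1 (fun s => u s z.2 0 i) z.1 = 'D_(1, 0) U z 0 i by
  rewrite -Du derive_mx// mxE.
Qed.

Lemma is_derive_theta2 z : Q z ->
  is_derive z.1 (1 : R) (t2 ^~ z.2) ('D_(1, 0) t2' z).
Proof.
move=> Oz; case: sol => _ [_ [_ [/(_ [::] z Oz) dt2 _]]].
have /derivable_time/derivableP : derivable t2' z (1, 0).
  exact: diff_derivable.
by rewrite derive_time.
Qed.

(** The flux at the old level is eliminated by means of the momentum equation.
The pressure and the weight are implicit in the scheme, hence their increment
over one step. *)
Lemma mom_resE h z i : Q z ->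
  mom_res (limiting_scheme gamma B) h (w z.1) (w (z.1 + h)) z.2 0 i =
  (h^-1 * (rho0 B z.2 * u (z.1 + h) z.2 0 i - rho0 B z.2 * u z.1 z.2 0 i)
   - dtmom i z) + (force i (z.1 + h, z.2) - force i z).
Proof.
move=> Oz; have [_ Oz2] := Oz; case: sol => _ [_ [_ [_]]].
have zE : (z.1, z.2) = z by case: z {Oz Oz2}.
have := Oz; rewrite -{1}zE => Oz' /(_ _ _ Oz')[_ [eqm _]].
have [du Du] := is_derive_velocity Oz.
have := congr1 (fun m : 'rV[R]_d => m 0 i) eqm.
rewrite /= derive1E deriveZ// Du.
set A := divT _ _; set A' := divT _ _.
have -> : A = A'.
  rewrite /A /A'; apply/rowP => j; rewrite !mxE; apply: eq_bigr => k _.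
  apply: near_eq_derive; apply: filterS (near_Omega backgroundB Oz2) => y Oy.
  by rewrite lvel_state_of.
have qE s : partial i (q2 s) z.2 = 'D_(0, delta_mx 0 i) q2' (s, z.2).
  by rewrite -derive_space.
move: A' => A'; rewrite !mxE /dtmom /force /= !qE zE => H.
have {H} -> : A' 0 i = - r2 z.1 z.2 * partial i (Phi B) z.2 -
  rho0 B z.2 * 'D_(1, 0) U z 0 i - 'D_(0, delta_mx 0 i) q2' z.
  by rewrite -H; ring.
ring.
Qed.

Lemma theta_resE h z : Q z ->
  theta_res (limiting_scheme gamma B) h (w z.1) (w (z.1 + h)) z.2 =
  h^-1 * (t2 (z.1 + h) z.2 - t2 z.1 z.2) - 'D_(1, 0) t2' z.
Proof.
move=> Oz; have [_ Oz2] := Oz; case: sol => _ [_ [_ [_]]].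
have zE : (z.1, z.2) = z by case: z {Oz Oz2}.
have := Oz; rewrite -{1}zE => Oz' /(_ _ _ Oz')[_ [_ [eqt _]]].
have [_ Dt] := is_derive_theta2 Oz.
rewrite /= lvel_state_of// mulrC; congr (_ + _).
by apply/eqP; rewrite -addr_eq0 addrC -Dt -derive1E eqt.
Qed.

Lemma limit_solution_constraint t : 0 < t < T ->
  constraint (limiting_scheme gamma B) (w t).
Proof.
move=> tT x Ox; case: sol => _ [_ [_ [_ /(_ t x)]]].
by move=> /(_ (conj tT Ox))[dv [_ [_ cl]]].
Qed.

(** The estimates hold near each point of [K] for all small steps; since [K] is
compact, one bound on the step serves all of [K]. *)
Lemma residuals_cvg0 (K : set (R * V)) e : compact K -> K `<=` Q -> 0 < e ->
  \forall h \near 0^'+, forall t x, K (t, x) ->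
    `|mom_res (limiting_scheme gamma B) h (w t) (w (t + h)) x| < e /\
    `|theta_res (limiting_scheme gamma B) h (w t) (w (t + h)) x| < e.
Proof.
move=> /compact_near_coveringP cK KQ e0.
pose P (h : R) (z : R * V) :=
  `|mom_res (limiting_scheme gamma B) h (w z.1) (w (z.1 + h)) z.2| < e /\
  `|theta_res (limiting_scheme gamma B) h (w z.1) (w (z.1 + h)) z.2| < e.
have near_P z0 : K z0 -> \forall z \near z0 & h \near (0 : R)^'+, P h z.
  move=> /KQ Oz0; have nearQ := near_spacetime Oz0.
  have e20 : 0 < e / 2 by rewrite divr_gt0.
  have nmom i : \forall z \near z0 & h \near (0 : R)^'+,
      `|h^-1 * (rho0 B z.2 * u (z.1 + h) z.2 0 i -
         rho0 B z.2 * u z.1 z.2 0 i) - dtmom i z| < e / 2.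
    apply: (near_difference_quotient
      (f := fun s x => rho0 B x * u s x 0 i)) => //.
    - by apply: filterS nearQ => z; exact: is_derive_momentum.
    - exact: continuous_dtmom.
  have nforce i : \forall z \near z0 & h \near (0 : R)^'+,
      `|force i (z.1 + h, z.2) - force i z| < e / 2.
    by apply: near_time_increment => //; exact: continuous_force.
  have ntheta : \forall z \near z0 & h \near (0 : R)^'+,
      `|h^-1 * (t2 (z.1 + h) z.2 - t2 z.1 z.2) - 'D_(1, 0) t2' z| < e.
    apply: near_difference_quotient => //.
    - by apply: filterS nearQ => z; exact: is_derive_theta2.
    - by apply: smooth_derive_continuous => //; case: sol => _ [_ [_ []]].
  have nQ : \forall z \near z0 & h \near (0 : R)^'+, Q z.
    exact: cvg_fst nearQ.
  pose momh i (z : R * V) (h : R) :=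
      `|h^-1 * (rho0 B z.2 * u (z.1 + h) z.2 0 i -
         rho0 B z.2 * u z.1 z.2 0 i) - dtmom i z| < e / 2 /\
      `|force i (z.1 + h, z.2) - force i z| < e / 2.
  have nall : \forall z \near z0 & h \near (0 : R)^'+, forall i, momh i z h.
    apply: (filter_forall (f := fun i (zh : (R * V) * R) => momh i zh.1 zh.2)
      (F := filter_prod (nbhs z0) (0 : R)^'+)) => i.
    exact: filterI (nmom i) (nforce i).
  apply: filterS3 nQ nall ntheta => -[z h] /= Oz mh thetah; split.
    apply: ltr_rV_norm => // i; rewrite mom_resE//.
    have [m1 m2] := mh i.
    by rewrite (le_lt_trans (ler_normD _ _))// (splitr e) ltrD.
  by rewrite theta_resE.
have KP : \forall h \near (0 : R)^'+, K `<=` P h.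
  exact: (cK _ _ P _ near_P).
by apply: filterS KP => h KP t x Ktx; exact: (KP (t, x) Ktx).
Qed.

End Consistency.

Theorem theorem4p1 (R : realType) (d : nat) (gamma : R) (B : background R d)
    (gamma_gt1 : 1 < gamma)
    (backgroundB : is_background gamma B)
    (theta0_const : exists c : R, forall x, Omega B x -> theta0 B x = c) :
  (forall (dt : R) (S : R -> run R d) (C : R -> coeffs R d)
      (L : nat -> limstate R d),
    0 < dt ->
    (forall eps, 0 < eps <= 1 -> imex_scheme gamma eps dt B (S eps)) ->
    (forall eps, 0 < eps <= 1 -> well_prepared gamma eps B (S eps) (C eps)) ->
    (forall eps, 0 < eps <= 1 ->
       forall n, (1 <= n)%N -> expansion eps B (S eps) (C eps) n) ->
    (forall eps, 0 < eps <= 1 -> new_level_density eps B (S eps)) ->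
    limit_coeffs B S C L ->
    forall n, scheme_step B (limiting_scheme gamma B) dt (L n) (L n.+1)) /\
  consistent_discretization gamma B (limiting_scheme gamma B).
Proof.
split=> [dt S C L dt0 schemeS prepS expS densS limS n|].
  exact: (limiting_step gamma_gt1 backgroundB theta0_const dt0 schemeS prepS
    expS densS limS).
split=> [w wC x Ox|T u r2 q2 t2 sol /=]; first by have [_ [_ []]] := wC x Ox.
split=> [t tT|K cK KQ e e0]; first exact: (limit_solution_constraint sol tT).
exact: (residuals_cvg0 backgroundB sol cK KQ e0).
Qed.
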